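(* For any $\varepsilon\in(0,1)$, any memory-bounded algorithm with an $m$-bit memory that $\varepsilon$-approximates $q\mathrm{SA}$ (for $q=1$ and $d'=1$) on the subclass of causal instances of length $N$ must have memory $m\ge(N-1)/2$.
   Context: Memory-bounded algorithm. An algorithm with $m$-bit memory processes $X=(x_1,\dots,x_N)\in\mathbb{R}^{N\times d}$ sequentially: there is an initial memory state $h_0\in\{0,1\}^m$, and for $i=1,\dots,N$ it computes the $i$-th output $f(X)_i\in\mathbb{R}^{d'}$ and new memory state $h_i$ by $(f(X)_i,h_i)=g_i(x_i,h_{i-1})$, where $g_i:\mathbb{R}^d\times\{0,1\}^m\to\mathbb{R}^{d'}\times\{0,1\}^m$ is permitted to be an arbitrary function. The function computed by the algorithm is $f:\mathbb{R}^{N\times d}\to\mathbb{R}^{N\times d'}$. Sparse averaging. Inputs are $X$ with $x_i=(z_i,y_i,i)$, where $z_i$ lies in the Euclidean unit ball of $\mathbb{R}^{d'}$ and $y_i$ is a $q$-element subset of $[N]=\{1,\dots,N\}$; $q\mathrm{SA}(X)_i=\frac1q\sum_{j\in y_i}z_j$. (The causal instances below also allow $y_i=\emptyset$, for which the sum is empty, i.e. $q\mathrm{SA}(X)_i=0$.) Causal instances: those $X=((z_i,y_i,i))_{i\in[N]}$ promised to satisfy $y_i=\emptyset$ for all $i\le N/2+1$ and $y_i\subseteq\{1,\dots,N/2+1\}$ for all $i>N/2+1$. $f$ $\varepsilon$-approximates $q\mathrm{SA}$ on the causal instances if for every causal $X$, $\max_{i\in[N]}\|f(X)_i-q\mathr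m{SA}(X)_i\|_2\le\varepsilon$.
   Formalization: The length N = 2 is excluded: there every position is at most N/2+1, so all y_i are empty, qSA is identically 0, and a zero-memory algorithm outputting 0 contradicts the claimed bound m ≥ 1/2. *)

(* Defs.v *)
From mathcomp Require Import all_boot all_order all_algebra.
From mathcomp Require Import reals.

Set Implicit Arguments.
Unset Strict Implicit.
Unset Printing Implicit Defensive.

Import Order.TTheory GRing.Theory Num.Theory.
Local Open Scope ring_scope.

(* Positions 1, ..., N are represented by 'I_N: the position of i : 'I_N is
   i.+1. *)

(* The canonical norm `|v| on matrices is the sup norm. *)
Definition l2norm (R : realType) (n : nat) (v : 'rV[R]_n) : R :=
  Num.sqrt (\sum_(j < n) v 0 j ^+ 2).

Record mem_alg (R : realType) (N d d' m : nat) := MemAlg {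
  mem_init : m.-tuple bool;
  mem_step : 'I_N -> 'rV[R]_d * m.-tuple bool -> 'rV[R]_d' * m.-tuple bool
}.

(* The state h_k reached after processing the first k rows of X; it is constant
   for k >= N. *)
Fixpoint mem_state (R : realType) (N d d' m : nat) (A : mem_alg R N d d' m)
    (X : 'M[R]_(N, d)) (k : nat) : m.-tuple bool :=
  if k is k'.+1 then
    let h := mem_state A X k' in
    if insub k' is Some i then (mem_step A i (row i X, h)).2 else h
  else mem_init A.

Definition mem_fun (R : realType) (N d d' m : nat) (A : mem_alg R N d d' m)
    (X : 'M[R]_(N, d)) : 'M[R]_(N, d') :=
  \matrix_(i < N) (mem_step A i (row i X, mem_state A X i)).1.

(* A subset of {1, ..., N} with at most q elements is written as the increasing
   list of its elements, padded with zeros to length q; in particular the empty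
   set is the zero vector, and the encoding is injective. *)
Definition enc_set (R : realType) (N q : nat) (S : {set 'I_N}) : 'rV[R]_q :=
  \row_(k < q) nth 0 [seq (val j).+1%:R | j in S] k.

(* The matrix in R^{N x (d' + q + 1)} whose rows are x_i = (z_i, y_i, i). *)
Definition qSA_input (R : realType) (N d' q : nat)
    (z : 'M[R]_(N, d')) (y : 'I_N -> {set 'I_N}) : 'M[R]_(N, d' + (q + 1)) :=
  \matrix_(i < N)
    row_mx (row i z) (row_mx (enc_set R q (y i)) (const_mx (val i).+1%:R)).

Definition qSA (R : realType) (N d' q : nat)
    (z : 'M[R]_(N, d')) (y : 'I_N -> {set 'I_N}) : 'M[R]_(N, d') :=
  \matrix_(i < N) (q%:R^-1 *: \sum_(j in y i) row j z).

(* The condition "position of i <= N/2 + 1", where N/2 is an exact quotient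
   (N may be odd). *)
Definition in_first_half (N : nat) (i : 'I_N) : bool :=
  (val i).+1%:R <= N%:R / 2 + 1 :> rat.

Definition causal_instance (R : realType) (N d' q : nat)
    (z : 'M[R]_(N, d')) (y : 'I_N -> {set 'I_N}) : Prop :=
  [/\ forall i, l2norm (row i z) <= 1,
      forall i, y i = set0 \/ #|y i| = q,
      forall i, in_first_half i -> y i = set0
    & forall i, ~~ in_first_half i -> {in y i, forall j, in_first_half j}].

Definition approximates_causal_qSA (R : realType) (N d' q : nat) (eps : R)
    (f : 'M[R]_(N, d' + (q + 1)) -> 'M[R]_(N, d')) : Prop :=
  forall (z : 'M[R]_(N, d')) (y : 'I_N -> {set 'I_N}),
    causal_instance q z y ->
    \big[Num.max/0]_(i < N)
      l2norm (row i (f (qSA_input q z y)) - row i (qSA q z y)) <= eps.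

(* Main.v *)
Require Import Defs.
From mathcomp Require Import all_boot all_order all_algebra.
From mathcomp Require Import reals.
From mathcomp Require Import lra zify.

Import Order.TTheory GRing.Theory Num.Theory.
Local Open Scope ring_scope.

(** Give the first-half positions arbitrary signs, and let only the last
    position query, asking for the sign at a position [j] of the first half.
    The state reached just before the last row does not depend on [j], yet
    together with the last row it determines every queried sign, since
    [eps < 1].  Hence distinct sign patterns reach distinct states, and [2 ^ m]
    is at least the number of sign patterns. *)

Lemma mem_state_eq (R : realType) (N d d' m : nat) (A : mem_alg R N d d' m)
    (X Y : 'M[R]_(N, d)) (k : nat) :
  (forall i : 'I_N, (i < k)%N -> row i X = row i Y) ->
  mem_state A X k = mem_state A Y k.
Proof.
elim: k => //= k IHk eqXY.
rewrite IHk => [|i lt_ik]; last by apply: eqXY; apply: ltnW.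
by case: insubP => // i _ def_i; rewrite eqXY // def_i.
Qed.

Lemma l2norm1 (R : realType) (v : 'rV[R]_1) : l2norm v = `|v 0 0|.
Proof. by rewrite /l2norm big_ord1 sqrtr_sqr. Qed.

(** As [i] is zero-based, the [+ 1] cancels on both sides; doubling clears the exact quotient, for
    odd [N] too. *)
Lemma in_first_halfE (N : nat) (i : 'I_N) : in_first_half i = (i.*2 <= N)%N.
Proof.
rewrite /in_first_half -(ler_nat rat) -addn1 natrD -muln2 natrM.
by apply/idP/idP; lra.
Qed.

(** All indices below [N./2] qualify. For [N > 0] the index [N./2] does too, but this count suffices
    because [N <= (N./2).*2.+1]. *)
Lemma leq_half_card_first_half (N : nat) :
  (N./2 <= #|[set i : 'I_N | in_first_half i]|)%N.
Proof.
have le_half : (N./2 <= N)%N by lia.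
have widen_inj : injective (widen_ord le_half).
  by move=> i j /(congr1 val) /= eq_ij; apply: val_inj.
rewrite -[leqLHS]card_ord -(card_imset predT widen_inj).
apply/subset_leq_card/subsetP => _ /imsetP[i _ ->].
by rewrite inE in_first_halfE /=; have := ltn_ord i; lia.
Qed.

Lemma qSA_input_row_eq {R : realType} {N d' : nat} (q : nat)
    {z z' : 'M[R]_(N, d')} {y y' : 'I_N -> {set 'I_N}} {i : 'I_N} :
  row i z = row i z' -> y i = y' i ->
  row i (qSA_input q z y) = row i (qSA_input q z' y').
Proof. by move=> eqz eqy; rewrite !rowK eqz eqy. Qed.

Lemma approximates_causal_qSA_row {R : realType} {N d' q : nat} {eps : R}
    {f : 'M[R]_(N, d' + (q + 1)) -> 'M[R]_(N, d')}
    {z : 'M[R]_(N, d')} {y : 'I_N -> {set 'I_N}} (i : 'I_N) :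
  approximates_causal_qSA eps f -> causal_instance q z y ->
  l2norm (row i (f (qSA_input q z y)) - row i (qSA q z y)) <= eps.
Proof.
move=> approx_f causal; apply: le_trans (approx_f z y causal).
exact: (le_bigmax _ (fun k => l2norm (row k _ - row k _))).
Qed.

(** Indexing sign patterns by sets makes counting them a powerset cardinality. *)
Definition sign_col (R : realType) {N : nat} (S : {set 'I_N}) : 'cV[R]_N :=
  \col_i (if i \in S then 1 else -1).

Definition last_query {n : nat} (B : {set 'I_n.+1}) (i : 'I_n.+1) :
    {set 'I_n.+1} :=
  if i == ord_max then B else set0.

Lemma last_query_causal (R : realType) {n : nat} (S : {set 'I_n.+1})
    {j : 'I_n.+1} :
  (1 < n)%N -> in_first_half j ->
  causal_instance 1 (sign_col R S) (last_query [set j]).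
Proof.
move=> n_gt1 Pj; split=> i.
- by rewrite l2norm1 !mxE; case: ifP; rewrite ?normrN normr1.
- by rewrite /last_query; case: eqP => _; [right; rewrite cards1 | left].
- rewrite /last_query; case: eqP => // ->.
  (* The last index [n] lies outside the first half exactly when [n.*2 > n.+1], that is, [n > 1]. *)
  by rewrite in_first_halfE /=; lia.
- rewrite /last_query => _ k; case: eqP => _; rewrite !inE //.
  by move=> /eqP->.
Qed.

(** The empty last query gives a reference state that serves every queried position [j] at once. *)
Lemma sign_state_inj {R : realType} {eps : R} {n m : nat}
    {A : mem_alg R n.+1 (1 + (1 + 1)) 1 m} :
  eps < 1 -> (1 < n)%N ->
  @approximates_causal_qSA R n.+1 1 1 eps (mem_fun A) ->
  {in powerset [set i | in_first_half i] &,
    injective (fun S : {set 'I_n.+1} =>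
      mem_state A (qSA_input 1 (sign_col R S) (last_query set0)) n)}.
Proof.
move=> eps_lt1 n_gt1 approxA S T; rewrite !powersetE.
move=> /subsetP sSP /subsetP sTP eq_state.
have notP_max : ord_max \notin [set i : 'I_n.+1 | in_first_half i].
  by rewrite inE in_first_halfE /=; lia.
(* The last row must not reveal the pattern: its own sign is [-1] for both sets. *)
have eq_last : row ord_max (sign_col R S) = row ord_max (sign_col R T).
  apply/rowP=> k; rewrite !mxE.
  by rewrite (negbTE (contra (sSP _) notP_max)) (negbTE (contra (sTP _) notP_max)).
have state_query (U B : {set 'I_n.+1}) :
    mem_state A (qSA_input 1 (sign_col R U) (last_query B)) n =
    mem_state A (qSA_input 1 (sign_col R U) (last_query set0)) n.
  apply: mem_state_eq => i lt_in; apply: qSA_input_row_eq => //.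
  by rewrite /last_query -val_eqE /= ltn_eqF.
suff eq_mem j : in_first_half j -> (j \in S) = (j \in T).
  apply/setP=> j; case: (boolP (in_first_half j)) => [/eq_mem //|nPj].
  have nPj' : j \notin [set i | in_first_half i] by rewrite inE.
  by rewrite (negbTE (contra (sSP _) nPj')) (negbTE (contra (sTP _) nPj')).
move=> Pj.
pose out U := mem_fun A (qSA_input 1 (sign_col R U) (last_query [set j])).
have out_approx U : `|out U ord_max 0 - (if j \in U then 1 else -1)| <= eps.
  have := approximates_causal_qSA_row ord_max approxA
            (last_query_causal R U n_gt1 Pj).
  rewrite l2norm1 -/(out U) [row _ (qSA _ _ _)]rowK /last_query eqxx big_set1.
  by rewrite invr1 scale1r mxE [row _ (out U) 0 0]mxE !mxE.
have eq_out : out S ord_max 0 = out T ord_max 0.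
  rewrite /out !mxE !state_query eq_state.
  by rewrite (qSA_input_row_eq 1 eq_last erefl).
(* If [S] and [T] disagreed at [j], one output would be within [eps < 1] of both [1] and [-1]. *)
have := out_approx S; have := out_approx T; rewrite eq_out !ler_norml.
by case: (j \in S); case: (j \in T) => // /andP[? ?] /andP[? ?]; lra.
Qed.

Theorem theorem11 (R : realType) (eps : R) (heps : 0 < eps < 1)
    (N m : nat) (hN : N <> 2%N)
    (A : mem_alg R N (1 + (1 + 1)) 1 m)
    (hA : @approximates_causal_qSA R N 1 1 eps (mem_fun A)) :
  (N%:R - 1) / 2 <= m%:R :> R.
Proof.
suff le_half : (N <= m.*2.+1)%N.
  move: le_half; rewrite -(ler_nat R) -addn1 natrD -muln2 natrM; lra.
(* For [N <= 1] the bound is immediate. At [N = 2] both positions are in the first half, so none may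
   query. *)
case: N => [|[|[|n]]] // in hN A hA *.
have /andP[_ eps_lt1] := heps.
have inj := sign_state_inj eps_lt1 (isT : (1 < n.+2)%N) hA.
(* Distinct reached states number at most [2 ^ m]; comparing exponents bounds the size of the first
   half by [m]. *)
have := max_card (mem [set mem_state A
  (qSA_input 1 (sign_col R S) (last_query set0)) n.+2
  | S in powerset [set i | in_first_half i]]).
rewrite (card_in_imset inj) card_powerset card_tuple card_bool leq_exp2l //.
by move/(leq_trans (leq_half_card_first_half n.+3)); lia.
Qed.
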